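(* Let $s$ be a positive integer, $q:=2^s$, $M:=\frac{2^{3s}-1}{2^s-1}$, $F:=\mathbb{F}_{2^{3s}}$, and let $T_1,T_2,T_3$ be the partition of $\mathbb{Z}_M$ and $C_i^{(M,F)}$ $(i\in\mathbb{Z}_M)$ the cyclotomic classes of order $M$ of $F$ defined in the context. Put $$R_0=\{0\},\quad R_1=\bigcup_{i\in T_1} C_i^{(M,F)},\quad R_2=\bigcup_{i\in T_2} C_i^{(M,F)},\quad R_3=\bigcup_{i\in T_3} C_i^{(M,F)}.$$ Then $(F,\{R_i\}_{i=0}^3)$ is a three-class association scheme. Its parameters are as follows: the intersection matrices $B_i$ $(i=1,2,3)$, whose $(k,j)$ entry is the intersection number $p_{i,j}^k$ $(0\le k,j\le 3)$, are $$B_1=\begin{pmatrix} 0&q^2-1&0&0\\ 1&q^2-2&0&0\\ 0&0&\frac{1}{2} q^2+\frac{1}{2} q-1&\frac{1}{2} q (q-1)\\ 0&0&\frac{1}{2} q (q+1)&\frac{1}{2} (q-2) (q+1) \end{pmatrix},$$ $$B_2=\begin{pmatrix} 0&0&\frac{1}{2} q^3-\frac{1}{2} q&0\\ 0&0&\frac{1}{4} q (q^2+q-2)&\frac{1}{4} q^2 (q-1)\\ 1&\frac{1}{2} q^2+\frac{1}{2} q-1&\frac{1}{4} (q^2+q-6) q&\frac{1}{4} (q^2-3 q+2) q\\ 0&\frac{1}{2} q (q+1)&\frac{1}{4} (q-2) q (q+1)&\frac{1}{4} (q-2) q (q+1) \end{pmatrix},$$ $$B_3=\begin{pmatrix} 0&0&0&\frac{1}{2}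 q^3-q^2+\frac{1}{2} q\\ 0&0&\frac{1}{4} q^2 (q-1)&\frac{1}{4} (q^2-3 q+2) q\\ 0&\frac{1}{2} q (q-1)&\frac{1}{4} (q^2-3 q+2) q&\frac{1}{4} (q^2-3 q+2) q\\ 1&\frac{1}{2} (q-2) (q+1)&\frac{1}{4} (q-2) q (q+1)&\frac{1}{4} q (q^2-5 q+6) \end{pmatrix}.$$
   Context: Association schemes. Let $X$ be a nonempty finite set and let $\mathcal{R}_0,\mathcal{R}_1,\dots,\mathcal{R}_d$ be symmetric relations partitioning $X\times X$ with $\mathcal{R}_0=\{(x,x): x\in X\}$. Let $A_i$ be the adjacency matrix of $\mathcal{R}_i$ (its $(x,y)$ entry is $1$ if $(x,y)\in \mathcal{R}_i$ and $0$ otherwise). $(X,\{\mathcal{R}_i\}_{i=0}^d)$ is a $d$-class association scheme if there are numbers $p_{i,j}^k$ (the intersection numbers) with $A_iA_j=\sum_{k=0}^d p_{i,j}^kA_k$ for all $i,j$. The matrix $B_i$ is defined by $A_i(A_0,A_1,\dots,A_d)=(A_0,A_1,\dots,A_d)B_i$, so its $(k,j)$ entry is $p_{i,j}^k$. If $X$ is a finite additive abelian group and $S_0=\{0\},S_1,\dots,S_d$ is a partition of $X$, then ''$(X,\{S_i\}_{i=0}^d)$ is an association scheme'' means that the relations $\mathcal{R}_i=\{(x,x+y): x\in X,\ y\in S_i\}$ form an association scheme on $X$. Fields and cyclotomic classes. $F=\mathbb{F}_{2^{3s}}$, $E=\mathbb{F}_{2^s}\subset F$, $\mathrm{Tr}_{F/E}$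 is the trace from $F$ to $E$, and $\omega$ is a fixed primitive element of $F$. Put $C_0^{(M,F)}=\langle\omega^M\rangle$ $(=E^* )$ and $C_i^{(M,F)}=\omega^iC_0^{(M,F)}$; this depends only on $i$ modulo $M$. The partition of $\mathbb{Z}_M$. For $a\in\mathbb{Z}_M$ let $$S_a:=\{u\in F^*: \mathrm{Tr}_{F/E}(u^{1+2^s})=0,\ \mathrm{Tr}_{F/E}(\omega^a u)=0\}.$$ The size of $S_a$ depends only on $a$ modulo $M$ and is always $0$, $2^s-1$ or $2(2^s-1)$. Let $T_1$ be the set of $a\in\mathbb{Z}_M$ with $|S_a|=2^s-1$, $T_2$ the set of $a\in\mathbb{Z}_M$ with $|S_a|=2(2^s-1)$, and $T_3=\mathbb{Z}_M\setminus(T_1\cup T_2)$ (so $|S_a|=0$ for $a\in T_3$). *)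

(* Defs.v *)
From HB Require Import structures.
From mathcomp Require Import all_boot all_order all_algebra.
From mathcomp Require Import all_fingroup all_solvable all_field.

Set Implicit Arguments.
Unset Strict Implicit.
Unset Printing Implicit Defensive.

Import GRing.Theory.
Local Open Scope ring_scope.

(* Rows and columns are indexed by the elements of X through [enum_val].      *)
Definition adjacency_mx (X : finType) (r : {set X * X}) : 'M[rat]_#|X| :=
  \matrix_(x, y) ((enum_val x, enum_val y) \in r)%:R.

Definition intersection_numbers (X : finType) (d : nat)
    (R : 'I_d.+1 -> {set X * X}) (p : 'I_d.+1 -> 'I_d.+1 -> 'I_d.+1 -> rat) :=
  forall i j, adjacency_mx (R i) *m adjacency_mx (R j) =
                \sum_k p i j k *: adjacency_mx (R k).

(* [partition] makes all the R i nonempty and, together with the injectivity  *)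
(* of R, pairwise disjoint; hence the intersection numbers are unique.        *)
Definition association_scheme (X : finType) (d : nat)
    (R : 'I_d.+1 -> {set X * X}) : Prop :=
  [/\ injective R /\ partition [set R i | i : 'I_d.+1] [set: X * X],
      R ord0 = [set (x, x) | x : X],
      forall i x y, ((x, y) \in R i) = ((y, x) \in R i)
    & exists p, intersection_numbers R p].

Definition translation_relations (X : finZmodType) (d : nat)
    (S : 'I_d.+1 -> {set X}) (i : 'I_d.+1) : {set X * X} :=
  [set (x, x + y) | x : X, y : X in S i].

(* The matrix B_i, whose (k, j) entry is p_{i,j}^k.                           *)
Definition intersection_mx (d : nat)
    (p : 'I_d.+1 -> 'I_d.+1 -> 'I_d.+1 -> rat) (i : 'I_d.+1) : 'M[rat]_d.+1 :=
  \matrix_(k, j) p i j k.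

Lemma pchar2 (s : nat) (F : finFieldType) (cardF : #|F| = (2 ^ (3 * s))%N) :
  2%N \in [pchar F].
Proof. exact: card_finPcharP cardF _. Qed.

(* F seen as an extension of its prime field 'F_2, the setting in which       *)
(* subfields, Galois groups and traces are available.                         *)
Notation extF cardF := (pPrimeCharType (pchar2 cardF)).

Definition numM (s : nat) : nat := ((2 ^ (3 * s) - 1) %/ (2 ^ s - 1))%N.

Section Cyclotomy.

Variables (s : nat) (F : finFieldType) (cardF : #|F| = (2 ^ (3 * s))%N).
Variables (E : {subfield (extF cardF)}) (w : {unit F}).

Local Notation M := (numM s).

Definition trFE (x : F) : F :=
  galTrace E {:extF cardF} (x : extF cardF).

(* For s > 0 we have M >= 7, so that 'Z_M is the ring of integers modulo M;   *)
(* a : 'Z_M is used as an exponent through its representative in [0, M).      *)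
Definition cyclotomic_class (i : 'Z_M) : {set F} :=
  [set val u | u in (w ^+ i *: <[w ^+ M]>)%g].

Definition S_ (a : 'Z_M) : {set {unit F}} :=
  [set u | (trFE (val u ^+ (1 + 2 ^ s)) == 0) &&
           (trFE (val w ^+ a * val u) == 0)].

Definition T1 : {set 'Z_M} := [set a | #|S_ a| == (2 ^ s - 1)%N].
Definition T2 : {set 'Z_M} := [set a | #|S_ a| == (2 * (2 ^ s - 1))%N].
Definition T3 : {set 'Z_M} := ~: (T1 :|: T2).

Definition R_ (i : 'I_4) : {set F} :=
  nth set0 [:: [set 0];
               \bigcup_(a in T1) cyclotomic_class a;
               \bigcup_(a in T2) cyclotomic_class a;
               \bigcup_(a in T3) cyclotomic_class a] i.

End Cyclotomy.

Definition mx_of_rows (n : nat) (rows : seq (seq rat)) : 'M[rat]_n :=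
  \matrix_(k, j) nth 0 (nth [::] rows k) j.

Definition B1 (q : rat) : 'M[rat]_4 := mx_of_rows 4
  [:: [:: 0; q ^+ 2 - 1; 0; 0];
      [:: 1; q ^+ 2 - 2; 0; 0];
      [:: 0; 0; 1 / 2 * q ^+ 2 + 1 / 2 * q - 1; 1 / 2 * q * (q - 1)];
      [:: 0; 0; 1 / 2 * q * (q + 1); 1 / 2 * (q - 2) * (q + 1)]].

Definition B2 (q : rat) : 'M[rat]_4 := mx_of_rows 4
  [:: [:: 0; 0; 1 / 2 * q ^+ 3 - 1 / 2 * q; 0];
      [:: 0; 0; 1 / 4 * q * (q ^+ 2 + q - 2); 1 / 4 * q ^+ 2 * (q - 1)];
      [:: 1; 1 / 2 * q ^+ 2 + 1 / 2 * q - 1;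
          1 / 4 * (q ^+ 2 + q - 6) * q; 1 / 4 * (q ^+ 2 - 3 * q + 2) * q];
      [:: 0; 1 / 2 * q * (q + 1);
          1 / 4 * (q - 2) * q * (q + 1); 1 / 4 * (q - 2) * q * (q + 1)]].

Definition B3 (q : rat) : 'M[rat]_4 := mx_of_rows 4
  [:: [:: 0; 0; 0; 1 / 2 * q ^+ 3 - q ^+ 2 + 1 / 2 * q];
      [:: 0; 0; 1 / 4 * q ^+ 2 * (q - 1); 1 / 4 * (q ^+ 2 - 3 * q + 2) * q];
      [:: 0; 1 / 2 * q * (q - 1);
          1 / 4 * (q ^+ 2 - 3 * q + 2) * q; 1 / 4 * (q ^+ 2 - 3 * q + 2) * q];
      [:: 1; 1 / 2 * (q - 2) * (q + 1);
          1 / 4 * (q - 2) * q * (q + 1); 1 / 4 * q * (q ^+ 2 - 5 * q + 6)]].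

(* Main.v *)
Require Import Defs.
From HB Require Import structures.
From mathcomp Require Import all_boot all_order all_algebra.
From mathcomp Require Import all_fingroup all_solvable all_field.
From mathcomp Require Import ring lra zify.

Import Order.TTheory GRing.Theory Num.Theory.
Local Open Scope ring_scope.

Set Implicit Arguments.
Unset Strict Implicit.
Unset Printing Implicit Defensive.

(** Write Q(u) = Tr(u^(1+q)) for u in F. This is the second elementary
symmetric function of the conjugates of u, hence a quadratic form on the
3-dimensional E-space F, with polar form Tr(x) Tr(y) + Tr(xy). In
characteristic 2 the radical of the polar form is E, where Q(c) = c^2, so the
zeros of Q form a conic of the projective plane over E with nucleus E. The set
S_a is the cone over the intersection of this conic with the line
Tr(w^a u) = 0: the lines through the nucleus, Tr(w^a) = 0, are tangent, and
the others are secant or external. So R_1, R_2, R_3 consist of the nonzero x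
whose line Tr(xu) = 0 is tangent, secant or external ([mem_R]).

All the geometry follows from one counting principle
([card_unique_translate]): if every translate w + E y of a set stable under
translation by E y meets a condition exactly once, the condition selects one
q-th of the set. Applied to y = 1 it counts the conic and the tangent lines,
because Q(w + c) = Q(w) + c^2 and squaring is bijective on E; applied to a
point y of the conic it shows that a line through y that avoids the nucleus
has exactly one further point on the conic.

For the intersection numbers, let g(x) be the number of vectors of the conic
on the line of x, and let f = g/(q-1) - 1; then f is 1, 0, -1 on R_2, R_1,
R_3, and f(0) = q. A sum of g(x) g(x+z) over x counts the triples (x, u, v)
with u and v on the conic, Tr(xu) = 0 and Tr(xv) = Tr(zv). When u and v are
independent there are q such x whatever z is; when they are dependent there
are q^2 or none according to whether Tr(zu) = 0. Hence the convolution of g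
with itself is an affine function of g ([sum_on_line_corr]), and that of f with
itself is q^2 f. The functions [x = 0], [Tr x = 0], 1 and f thus span an
algebra under convolution ([basis_convE]), which is also spanned by the
indicators of R_0, ..., R_3. Computing in it gives all intersection numbers
([conv_class_of]), and a partition of an abelian group whose indicators have
such convolutions is an association scheme
([translation_association_scheme]). *)

(** * The trace as a sum of Frobenius powers *)

Lemma mem_subfield_frobenius (s : nat) (F : finFieldType)
    (cardF : #|F| = (2 ^ (3 * s))%N)
    (E : {subfield (extF cardF)}) (cardE : #|E| = (2 ^ s)%N) (x : extF cardF) :
  (x \in E) = (x ^+ (2 ^ s) == x).
Proof.
rewrite Fermat's_little_theorem.
have := card_vspace (T := F) (E : {vspace extF cardF}).
by rewrite [LHS]cardE => <-.
Qed.

(** The Galois group of F over E is cyclic of order 3, generated by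
x |-> x^q; with this formula the rest of the argument needs only elementary
computation in F. *)
Lemma trFE_frobenius (s : nat) (s_gt0 : (0 < s)%N) (F : finFieldType)
    (cardF : #|F| = (2 ^ (3 * s))%N)
    (E : {subfield (extF cardF)}) (cardE : #|E| = (2 ^ s)%N) (x : F) :
  trFE E x = x + x ^+ (2 ^ s) + x ^+ (2 ^ s) ^+ (2 ^ s).
Proof.
have oE : (#|'F_2| ^ \dim E = 2 ^ s)%N.
  have := card_vspace (T := F) (E : {vspace extF cardF}).
  by rewrite [LHS]cardE => <-.
have oF : (#|'F_2| ^ \dim {:extF cardF} = 2 ^ (3 * s))%N.
  have := card_vspace (T := F) {: extF cardF}.
  move=> <-; rewrite -cardF; apply: eq_card => y.
  by rewrite [LHS](@memvf _ (extF cardF)).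
have sEF : (E <= {:extF cardF})%VS by rewrite subvf.
have [a gen_a aE] := finField_galois_generator sEF.
have dimEF : (\dim_E {:extF cardF} = 3)%N.
  move: oE oF; rewrite card_Fp //.
  move/(expnI (isT : 1 < 2)%N) => -> /(expnI (isT : 1 < 2)%N) ->.
  by rewrite mulnK.
have oa : #[a]%g = 3%N.
  by rewrite orderE -(eqP gen_a) -galois_dim // finField_galois.
have uniq_a : uniq (traject (mulg a) 1%g 3).
  rewrite -oa; apply/card_uniqP.
  by rewrite size_traject -(eq_card (cycle_traject a)).
have aX y : (a * a)%g y = y ^+ (2 ^ s) ^+ (2 ^ s).
  by rewrite galM ?memvf // !aE ?memvf ?oE.
rewrite /trFE /galTrace (eqP gen_a) (eq_bigl _ _ (cycle_traject a)) oa.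
rewrite -(big_uniq _ uniq_a) /= !big_cons big_nil mulg1 gal_id aX aE ?memvf //.
by rewrite oE addr0 addrA.
Qed.

(** * The trace form of a cubic extension in characteristic 2 *)

Section CubicExtension.

Variables (F : finFieldType) (s : nat).
Local Notation q := (2 ^ s)%N.

Definition tr (x : F) : F := x + x ^+ q + x ^+ q ^+ q.

Definition quad (x : F) : F := tr (x ^+ (1 + q)).

(** The subfield of order q, as the fixed points of the Frobenius map. *)
Definition base : {set F} := [set x | x ^+ q == x].

(** The vectors of the cone over the conic, without its vertex 0. *)
Definition conic : {set F} := [set u | (u != 0) && (quad u == 0)].

(** S_a with the vector w^a in place of the exponent a, and with field elements
in place of units. *)
Definition on_line (a : F) : {set F} := [set u in conic | tr (a * u) == 0].

Hypotheses (s_gt0 : (0 < s)%N) (cardF : #|F| = (2 ^ (3 * s))%N).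
Hypothesis card_base : #|base| = q.

Local Notation K := base.

Lemma q_gt1 : (1 < q)%N. Proof. by rewrite (ltn_exp2l 0). Qed.

Lemma q_gt0 : (0 < q)%N. Proof. by rewrite expn_gt0. Qed.

Lemma char2 : 2%N \in [pchar F]. Proof. exact: pchar2 cardF. Qed.

Lemma addxx (x : F) : x + x = 0. Proof. exact: addrr_pchar2 char2 x. Qed.

Lemma oppF (x : F) : - x = x. Proof. exact: oppr_pchar2 char2 x. Qed.

Lemma addF_eq (x y z : F) : (x + y == z) = (y == z + x).
Proof. by rewrite -[x in RHS]oppF eq_sym [RHS]eq_sym subr_eq addrC. Qed.

Lemma exprDq (x y : F) : (x + y) ^+ q = x ^+ q + y ^+ q.
Proof. by rewrite exprDn_pchar // pnatX pnatE // char2. Qed.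

Lemma exprqqq (x : F) : x ^+ q ^+ q ^+ q = x.
Proof.
by rewrite -!exprM -!expnD -[RHS]expf_card cardF; congr (x ^+ (2 ^ _)); lia.
Qed.

Lemma baseP (x : F) : reflect (x ^+ q = x) (x \in K).
Proof. by rewrite inE; apply: eqP. Qed.

Lemma base0 : 0 \in K.
Proof. by apply/baseP; rewrite expr0n gtn_eqF ?q_gt0. Qed.

Lemma base1 : 1 \in K. Proof. by apply/baseP; rewrite expr1n. Qed.

Lemma baseD x y : x \in K -> y \in K -> x + y \in K.
Proof. by move=> /baseP xK /baseP yK; apply/baseP; rewrite exprDq xK yK. Qed.

Lemma baseM x y : x \in K -> y \in K -> x * y \in K.
Proof. by move=> /baseP xK /baseP yK; apply/baseP; rewrite exprMn xK yK. Qed.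

Lemma baseV x : x \in K -> x^-1 \in K.
Proof. by move=> /baseP xK; apply/baseP; rewrite exprVn xK. Qed.

Lemma baseX x n : x \in K -> x ^+ n \in K.
Proof. by move=> /baseP xK; apply/baseP; rewrite exprAC xK. Qed.

Lemma trD x y : tr (x + y) = tr x + tr y.
Proof. by rewrite /tr !exprDq; ring. Qed.

Lemma trZ c x : c \in K -> tr (c * x) = c * tr x.
Proof. by move=> /baseP cK; rewrite /tr !exprMn !cK; ring. Qed.

Lemma tr_base c : c \in K -> tr c = c.
Proof. by move=> /baseP cK; rewrite /tr !cK addxx add0r. Qed.

Lemma tr0 : tr 0 = 0. Proof. exact: tr_base base0. Qed.

Lemma tr_in x : tr x \in K.
Proof. by apply/baseP; rewrite /tr !exprDq exprqqq; ring. Qed.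

Lemma tr_sqr x : tr (x ^+ 2) = tr x ^+ 2.
Proof.
have sqD (y z : F) : (y + z) ^+ 2 = y ^+ 2 + z ^+ 2.
  by rewrite sqrrD mulr2n addxx addr0.
by rewrite /tr !sqD !(exprAC _ 2).
Qed.

(** Q is the second elementary symmetric function of the conjugates. *)
Lemma quadE x :
  quad x = x * x ^+ q + x ^+ q * x ^+ q ^+ q + x ^+ q ^+ q * x.
Proof. by rewrite /quad /tr exprD expr1 !exprMn exprqqq. Qed.

Lemma quadD x y : quad (x + y) = quad x + quad y + (tr x * tr y + tr (x * y)).
Proof.
rewrite -[tr (x * y)]oppF !quadE /tr !exprDq !exprMn; ring.
Qed.

Lemma quadZ c x : c \in K -> quad (c * x) = c ^+ 2 * quad x.
Proof. by move=> /baseP cK; rewrite !quadE !exprMn !cK; ring. Qed.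

Lemma quad_base c : c \in K -> quad c = c ^+ 2.
Proof. by move=> /baseP cK; rewrite quadE !cK addxx add0r. Qed.

(** E is the radical of the polar form: translating by c in E just adds
c^2 to Q. *)
Lemma quadD_base x c : c \in K -> quad (x + c) = quad x + c ^+ 2.
Proof.
move=> cK; rewrite quadD (quad_base cK) (tr_base cK) [x * c]mulrC trZ //.
by rewrite [tr x * c]mulrC addxx addr0.
Qed.

(** Each c in K accounts for the w in W with P (w + c y), and translation by
c y puts these in bijection with the w in W satisfying P. *)
Lemma card_unique_translate (W : {set F}) (P : pred F) (y : F) :
    (forall w c, w \in W -> c \in K -> w + c * y \in W) ->
    (forall w, w \in W -> exists2 c, c \in K &
       forall d, d \in K -> P (w + d * y) = (d == c)) ->
  #|W| = (q * #|[set w in W | P w]|)%N.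
Proof.
move=> stabW oneP; rewrite -sum1_card.
transitivity (\sum_(w in W) \sum_(c in K | P (w + c * y)%R) 1)%N.
  apply: eq_bigr => w /oneP[c cK Pc].
  rewrite (eq_bigl (pred1 c)) ?big_pred1_eq // => d.
  by apply/andP/eqP => [[/Pc-> /eqP] | ->]; rewrite ?Pc.
under eq_bigr do rewrite big_mkcondr.
rewrite exchange_big /= -card_base -sum_nat_const; apply: eq_bigr => c cK.
rewrite -big_mkcondr -sum1_card /= [RHS](reindex_inj (addIr (c * y))) /=.
apply: eq_bigl => w; rewrite inE; congr (_ && _).
apply/idP/idP => [|wW]; first by move=> wW; apply: stabW.
by rewrite -[w]addr0 -(addxx (c * y)) addrA stabW.
Qed.

Lemma card_trace_line u a : u != 0 -> a \in K ->
  #|[set x | tr (x * u) == a]| = (q ^ 2)%N.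
Proof.
move=> u0 aK; apply/eqP; rewrite -(eqn_pmul2l q_gt0) -expnS -expnM.
rewrite [(s * 3)%N]mulnC -cardF eq_sym -cardsT.
rewrite (@card_unique_translate setT (fun x => tr (x * u) == a) u^-1) //.
  by apply/eqP; congr (q * _)%N; apply: eq_card => x; rewrite !inE.
  by move=> w c _ _; rewrite inE.
move=> w _; exists (a + tr (w * u)); first by rewrite baseD ?tr_in.
move=> d dK; rewrite mulrDl mulfVK // trD (tr_base dK).
exact: addF_eq.
Qed.

(** The orthogonal space of the trace-0 hyperplane is E: if v is not in E, its
trace-0 component t is nonzero, and pairing with t alone cannot vanish on the
hyperplane, since t^-1 t = 1 has trace 1. *)
Lemma trace_separates v : v \notin K ->
  exists2 y, tr y = 0 & tr (y * v) = 1.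
Proof.
move=> vK; have [t t0 ttr] : exists2 t, t != 0 & v = tr v + t /\ tr t = 0.
  exists (v + tr v); last first.
    by rewrite addrCA addxx addr0 trD (tr_base (tr_in v)) addxx.
  by apply: contra vK; rewrite addr_eq0 oppF => /eqP->; apply: tr_in.
have [vE trt] := ttr.
(* t^-1, projected along K onto the trace-0 hyperplane *)
pose y := t^-1 + tr t^-1.
exists y; first by rewrite trD (tr_base (tr_in _)) addxx.
rewrite vE mulrDr trD [y * tr v]mulrC trZ ?tr_in //.
rewrite {1}/y trD (tr_base (tr_in _)) addxx mulr0 add0r.
by rewrite /y mulrDl mulVf // trD trZ ?tr_in // trt mulr0 addr0 tr_base ?base1.
Qed.

(** Two distinct lines of the projective plane meet in one point; the values a
and b describe the translates of the corresponding subspaces. *)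
Lemma card_trace_point u v a b : u != 0 -> v / u \notin K -> a \in K -> b \in K ->
  #|[set x | (tr (x * u) == a) && (tr (x * v) == b)]| = q.
Proof.
move=> u0 vuK aK bK; have [y ty tyv] := trace_separates vuK.
apply/eqP; rewrite -(eqn_pmul2l q_gt0) -{3}[q]expn1 -expnS.
rewrite -(card_trace_line u0 aK) eq_sym.
rewrite (@card_unique_translate _ (fun x => tr (x * v) == b) (y / u)).
- by apply/eqP; congr (q * _)%N; apply: eq_card => x; rewrite !inE.
- move=> w c + cK; rewrite !inE => /eqP tw.
  by rewrite mulrDl trD -mulrA mulfVK // (trZ _ cK) ty tw mulr0 addr0.
move=> w _; exists (b + tr (w * v)); first by rewrite baseD ?tr_in.
move=> d dK; have -> : (w + d * (y / u)) * v = w * v + d * (y * (v / u)) by ring.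
rewrite trD (trZ _ dK) tyv mulr1.
exact: addF_eq.
Qed.

(** * The conic and its lines *)

(** Squaring is bijective on E, so each coset of the nucleus E contains exactly
one zero of Q. *)
Lemma quad_sqrt x : exists2 c, c \in K &
  forall d, d \in K -> (quad x + d ^+ 2 == 0) = (d == c).
Proof.
exists (quad x ^+ (2 ^ s.-1)); first by rewrite baseX ?tr_in.
have sq : quad x ^+ (2 ^ s.-1) ^+ 2 = quad x.
  by rewrite -exprM -expnSr prednK //; apply/baseP; apply: tr_in.
move=> d _; rewrite addF_eq add0r -[in LHS]sq -subr_eq0 oppF.
by rewrite -[RHS]subr_eq0 oppF -[RHS]sqrf_eq0 sqrrD mulr2n addxx addr0.
Qed.

Lemma card_quad_stable (W : {set F}) :
    (forall w c, w \in W -> c \in K -> w + c \in W) ->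
  #|W| = (q * #|[set w in W | quad w == 0%R]|)%N.
Proof.
move=> stabW; apply: (@card_unique_translate W (fun x => quad x == 0) 1) => w.
  by move=> c wW cK; rewrite mulr1 stabW.
move=> _; have [c cK cP] := quad_sqrt w; exists c => // d dK.
by rewrite mulr1 quadD_base ?cP.
Qed.

Lemma conic_base u : u \in conic -> u \notin K.
Proof.
rewrite inE => /andP[u0 /eqP Qu]; apply: contra u0 => uK.
by rewrite -sqrf_eq0 -quad_base // Qu.
Qed.

Lemma card_conic : #|conic| = (q ^ 2 - 1)%N.
Proof.
have := @card_quad_stable setT (fun _ _ _ _ => in_setT _).
rewrite cardsT cardF [(3 * s)%N]mulnC expnM expnS => /eqP.
rewrite eqn_pmul2l ?q_gt0 // => /eqP->.
rewrite [in RHS](cardsD1 0) inE quad_base ?base0 // expr0n eqxx inE addKn.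
by apply: eq_card => u; rewrite !inE.
Qed.

Lemma on_line0 : on_line 0 = conic.
Proof. by apply/setP => u; rewrite inE mul0r tr0 eqxx andbT. Qed.

(** A line through the nucleus is a union of cosets of E, hence tangent. *)
Lemma card_tangent a : a != 0 -> tr a = 0 -> #|on_line a| = (q - 1)%N.
Proof.
move=> a0 ta; pose W := [set w | tr (w * a) == 0].
have stabW w c : w \in W -> c \in K -> w + c \in W.
  rewrite ![_ \in W]inE mulrDl trD => /eqP-> cK.
  by rewrite (trZ _ cK) ta mulr0 addr0.
have := card_quad_stable stabW; rewrite card_trace_line ?base0 // expnS expn1.
move=> /eqP; rewrite eqn_pmul2l ?q_gt0 // => /eqP oW.
rewrite [X in (X - 1)%N]oW [in RHS](cardsD1 0) /W !inE mul0r tr0 eqxx.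
rewrite quad_base ?base0 // expr0n eqxx addKn.
by apply: eq_card => u; rewrite !inE mulrC -andbA; congr (_ && _); rewrite andbC.
Qed.

(** The point of the projective plane spanned by u. *)
Definition base_line (u : F) : {set F} := [set c * u | c in K].

Lemma base_lineP u v : u != 0 -> (v \in base_line u) = (v / u \in K).
Proof.
move=> u0; apply/imsetP/idP => [[c cK ->]|vuK]; first by rewrite mulfK.
by exists (v / u) => //; rewrite mulfVK.
Qed.

Lemma card_base_line u : u != 0 -> #|base_line u| = q.
Proof. by move=> u0; rewrite card_imset ?card_base //; apply: mulIf. Qed.

(** The polar form is nondegenerate on a line that avoids the nucleus. The
polar form of w and u is Tr(wz) for z = u + Tr(u), and Tr(uz) = Tr(z) = 0. If it
vanished, the lines of z and a would share the points u and w and so be equal,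
although only the first one passes through the nucleus. *)
Lemma polar_neq0 a u w : tr a != 0 -> u \in conic ->
    tr (u * a) = 0 -> tr (w * a) = 0 -> w \notin base_line u ->
  tr w * tr u + tr (w * u) != 0.
Proof.
move=> ta uO tua twa; have /[!inE]/andP[u0 Qu] := uO.
apply: contra => polar0; pose z := u + tr u.
have trM x y : tr (x * tr y) = tr x * tr y.
  by rewrite mulrC trZ ?tr_in // mulrC.
have tuz : tr (u * z) = 0 by rewrite mulrDr trD trM -!expr2 tr_sqr addxx.
have twz : tr (w * z) = 0 by rewrite mulrDr trD trM addrC (eqP polar0).
have a0 : a != 0 by apply: contra ta => /eqP->; rewrite tr0.
have za : z / a \notin K.
  apply: contra (conic_base uO) => zaK.
  have /eqP : tr z = 0 by rewrite trD (tr_base (tr_in u)) addxx.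
  rewrite -[z](mulfVK a0) trZ // mulf_eq0 (negPf ta) orbF mulf_eq0 invr_eq0.
  by rewrite (negPf a0) orbF addr_eq0 oppF => /eqP->; apply: tr_in.
have := card_trace_point a0 za base0 base0; set L := [set x | _] => oL.
have /eqP-> : base_line u == L.
  rewrite eqEcard card_base_line ?oL ?leqnn ?andbT //.
  apply/subsetP => _ /imsetP[c cK ->]; rewrite inE -!mulrA.
  by rewrite !(trZ _ cK) tua tuz mulr0 eqxx.
by rewrite inE twa twz eqxx.
Qed.

(** Let u be on the conic and on the line of a. Along a coset w + E u the form
Q is affine, with slope the polar form of w and u, which is nonzero when w is
not in E u; so each of these q - 1 cosets contains one zero of Q. Together with
the q - 1 nonzero multiples of u they make two points. *)
Lemma card_secant a u : tr a != 0 -> u \in on_line a ->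
  #|on_line a| = (2 * (q - 1))%N.
Proof.
move=> ta; rewrite inE => /andP[uO /eqP tau].
have /[!inE]/andP[u0 /eqP Qu] := uO.
have a0 : a != 0 by apply: contra ta => /eqP->; rewrite tr0.
pose L := [set x | tr (x * a) == 0].
have sKuL : base_line u \subset L.
  apply/subsetP => _ /imsetP[c cK ->]; rewrite inE -mulrA (trZ _ cK).
  by rewrite [u * a]mulrC tau mulr0.
pose W := L :\: base_line u.
have WP w : w \in W -> tr (w * a) = 0 /\ w \notin base_line u.
  by rewrite inE [w \in L]inE => /andP[? /eqP].
have oW : #|W| = (q * (q - 1))%N.
  rewrite cardsD (setIidPr sKuL) card_base_line // card_trace_line ?base0 //.
  by rewrite mulnBr muln1.
have stabW w c : w \in W -> c \in K -> w + c * u \in W.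
  move=> /WP[twa wu] cK; rewrite !inE mulrDl trD twa -mulrA (trZ _ cK).
  rewrite [u * a]mulrC tau mulr0 addr0 eqxx andbT.
  apply: contra wu; rewrite !base_lineP // mulrDl mulfK // => wcK.
  by rewrite -[w / u]addr0 -(addxx c) addrA baseD.
have oneP w : w \in W -> exists2 c, c \in K &
    forall d, d \in K -> (quad (w + d * u) == 0) = (d == c).
  move=> /WP[twa wu]; rewrite mulrC in tau.
  have := polar_neq0 ta uO tau twa wu; set b := (_ + _) => b0.
  have bK : b \in K by rewrite baseD ?baseM ?tr_in.
  exists (quad w / b) => [|d dK]; first by rewrite baseM ?baseV ?tr_in.
  rewrite quadD (quadZ _ dK) Qu mulr0 addr0 (trZ _ dK) [w * _]mulrCA (trZ _ dK).
  rewrite [tr w * _]mulrCA -mulrDr -/b addF_eq add0r.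
  by rewrite -(inj_eq (mulIf b0) d) mulfVK.
have := card_unique_translate (P := fun x => quad x == 0) stabW oneP.
rewrite oW => /eqP; rewrite eqn_pmul2l ?q_gt0 // => /eqP oZ.
have oZ' : #|base_line u :\ 0| = (q - 1)%N.
  rewrite -(card_base_line u0) [in RHS](cardsD1 0) base_lineP //.
  by rewrite mul0r base0 addKn.
rewrite mul2n -addnn {1}oZ -oZ' -cardsUI.
rewrite (_ : _ :&: _ = set0) ?cards0 ?addn0; last first.
  by apply/setP => w; rewrite !inE; case: (w \in base_line u); rewrite ?andbF.
apply: eq_card => w; rewrite !inE [a * w]mulrC.
have [/imsetP[c cK ->]|wu] /= := boolP (w \in base_line u).
  rewrite (quadZ _ cK) Qu mulr0 eqxx andbT -mulrA (trZ _ cK) [u * a]mulrC tau.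
  by rewrite mulr0 eqxx !andbT.
rewrite andbF orbF -andbA [RHS]andbC andb_idl // => _.
by apply: contraNneq wu => ->; rewrite base_lineP // mul0r base0.
Qed.

(** * Counting incidences *)

Lemma card_on_lineE x : #|on_line x| = (\sum_(u in conic) (tr (x * u)%R == 0%R))%N.
Proof.
rewrite -sum1_card -big_mkcondr /=.
by apply: eq_bigl => u; rewrite [in LHS]inE.
Qed.

(** A vector u of the conic is independent of 1, so the conditions Tr(x) = a
and Tr(xu) = 0 have q common solutions whatever a is. *)
Lemma sum_on_line_fiber a : a \in K ->
  (\sum_(x | tr x == a) #|on_line x| = (q ^ 2 - 1) * q)%N.
Proof.
move=> aK; under eq_bigr do rewrite card_on_lineE.
rewrite exchange_big /= -card_conic -sum_nat_const; apply: eq_bigr => u uO.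
have u1 : u / 1 \notin K by rewrite divr1 conic_base.
rewrite -(card_trace_point (oner_neq0 F) u1 aK base0) -sum1_card -big_mkcondr.
by apply: eq_bigl => x; rewrite inE mulr1.
Qed.

(** Count the triples (x, u, v) with u, v on the conic, Tr(xu) = 0 and
Tr((x+z)v) = 0. For fixed u, each of the q^2 - q vectors v independent of u
gives q solutions x; each of the q - 1 vectors v proportional to u gives q^2
solutions or none, according to whether u is on the line of z. *)
Lemma sum_on_line_corr z :
  (\sum_x #|on_line x| * #|on_line (x + z)%R|
     = (q ^ 2 - 1) * (q * (q ^ 2 - q)) + q ^ 2 * (q - 1) * #|on_line z|)%N.
Proof.
under eq_bigr do rewrite !card_on_lineE big_distrlr.
rewrite exchange_big /= card_on_lineE big_distrr /= -card_conic -sum_nat_const.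
rewrite -big_split; apply: eq_bigr => u uO; rewrite exchange_big /=.
have /[!inE]/andP[u0 /eqP Qu] := uO.
have oI : #|conic :&: base_line u| = (q - 1)%N.
  rewrite -(card_base_line u0) [in RHS](cardsD1 0) base_lineP // mul0r base0 addKn.
  apply: eq_card => v; rewrite inE [v \in _ :\ 0]inE inE.
  case: (boolP (v \in base_line u)) => [/imsetP[c cK ->]|]; rewrite ?andbF //.
  by rewrite [_ \in conic]inE (quadZ _ cK) Qu mulr0 eqxx !andbT.
rewrite (big_setID (base_line u)) /= addnC; congr (_ + _)%N.
  transitivity (\sum_(v in conic :\: base_line u) q)%N.
    apply: eq_bigr => v; rewrite inE base_lineP // => /andP[vu _].
    rewrite -(card_trace_point u0 vu base0 (tr_in (z * v))) -sum1_card.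
    rewrite [RHS]big_mkcond; apply: eq_bigr => x _; rewrite mulnb inE.
    by rewrite mulrDl trD [tr (x * v) + _ == 0]addr_eq0 oppF; case: (_ && _).
  rewrite sum_nat_const mulnC; congr (_ * _)%N.
  have := cardsID (base_line u) conic; rewrite card_conic oI.
  by move: q_gt1 => ? ?; lia.
rewrite (eq_bigr (fun=> (q ^ 2 * (tr (z * u)%R == 0%R))%N)); last first.
  move=> v; rewrite inE => /andP[vO /imsetP[c cK v_def]].
  have c0 : c != 0.
    by apply: contraTneq vO => c0; rewrite v_def c0 mul0r inE eqxx.
  rewrite -(card_trace_line u0 base0) -sum1_card big_distrl /= [RHS]big_mkcond.
  apply: eq_bigr => x _; rewrite mulnb inE v_def mulrCA (trZ _ cK).
  rewrite mulf_eq0 (negPf c0) /= mulrDl trD.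
  by case: eqP => //= ->; rewrite add0r; case: eqP.
by rewrite sum_nat_const oI mulnA [((q - 1) * _)%N]mulnC.
Qed.

(** * Convolutions of the class indicators *)

Local Notation Q := ((2 ^ s)%:R : rat).

(** 1, -1 or 0 when the line of x is secant, external or tangent. *)
Definition line_type (x : F) : rat :=
  if tr x == 0 then 0 else #|on_line x|%:R / (Q - 1) - 1.

Lemma Q1_neq0 : Q - 1 != 0.
Proof. by rewrite subr_eq0 pnatr_eq1 gtn_eqF ?q_gt1. Qed.

Lemma natr_q1 : (q - 1)%:R = Q - 1. Proof. by rewrite natrB ?q_gt0. Qed.

Lemma line_type_values x : tr x != 0 -> (line_type x == 1) || (line_type x == -1).
Proof.
move=> tx; rewrite /line_type (negPf tx).
have [x0|[u xu]] := set_0Vmem (on_line x).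
  by rewrite x0 cards0 mul0r sub0r eqxx orbT.
by rewrite (card_secant tx xu) natrM natr_q1 mulfK ?Q1_neq0.
Qed.

(** The term at x = 0 comes from the value q of |S_x| / (q-1) - 1 there, where
line_type is set to 0. *)
Lemma card_on_line_type x :
  #|on_line x|%:R = (Q - 1) * (line_type x + Q * (x == 0)%:R + 1) :> rat.
Proof.
rewrite /line_type; have [->|x0] := eqVneq x 0.
  rewrite on_line0 card_conic tr0 eqxx natrB ?expn_gt0 ?q_gt0 // natrX mulr1; ring.
case: eqP => [tx|_]; first by rewrite card_tangent // natr_q1 mulr0; ring.
by rewrite mulr0; field; exact: Q1_neq0.
Qed.

Lemma sum_1_fiber a : a \in K -> \sum_(x | tr x == a) (1 : rat) = Q ^+ 2.
Proof.
move=> aK; rewrite -natrX -(card_trace_line (oner_neq0 F) aK) -sum1_card natr_sum.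
by apply: eq_bigl => x; rewrite inE mulr1.
Qed.

Lemma sum_line_type_fiber a : a \in K ->
  \sum_(x | tr x == a) line_type x = Q * (1 - (a == 0)%:R).
Proof.
move=> aK; have [->|a0] := eqVneq a 0.
  by rewrite subrr mulr0 big1 // => x tx; rewrite /line_type tx.
rewrite (eq_bigr (fun x => #|on_line x|%:R / (Q - 1) - 1)); last first.
  by move=> x /eqP tx; rewrite /line_type tx (negPf a0).
rewrite big_split /= -mulr_suml -natr_sum sum_on_line_fiber // sumrN.
rewrite sum_1_fiber // natrM natrB ?expn_gt0 ?q_gt0 // natrX.
by rewrite subr0 mulr1; field; exact: Q1_neq0.
Qed.

Lemma sum_line_type : \sum_x line_type x = Q * (Q - 1).
Proof.
rewrite (partition_big tr (mem K)) /= => [|x _]; last exact: tr_in.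
rewrite (eq_bigr (fun a => Q * (1 - (a == 0)%:R))); last first.
  by move=> a aK; apply: sum_line_type_fiber.
rewrite -mulr_sumr big_split /= sumr_const card_base sumrN; congr (_ * (_ - _)).
by rewrite (bigD1 0) ?base0 //= eqxx big1 ?addr0 // => a /andP[_ /negPf->].
Qed.

(** Convolution, with x + z in place of z - x as the characteristic is 2. *)
Definition conv (a b : F -> rat) z := \sum_x a x * b (x + z).

Lemma convC a b z : conv a b z = conv b a z.
Proof.
rewrite [LHS](reindex_inj (addIr z)); apply: eq_bigr => x _.
by rewrite mulrC -addrA addxx addr0.
Qed.

Definition ind0 (x : F) : rat := (x == 0)%:R.
Definition ind_tr0 (x : F) : rat := (tr x == 0)%:R.

Lemma conv_ind0 b z : conv ind0 b z = b z.
Proof.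
rewrite /conv (bigD1 0) //= /ind0 eqxx mul1r add0r big1 ?addr0 // => x /negPf->.
by rewrite mul0r.
Qed.

Lemma conv_tr0 b z : conv ind_tr0 b z = \sum_(x | tr x == tr z) b x.
Proof.
rewrite [RHS](reindex_inj (addIr z)) [RHS]big_mkcond; apply: eq_bigr => x _.
rewrite trD [_ == tr z]eq_sym -subr_eq subrr eq_sym /ind_tr0.
by case: eqP; rewrite ?mul1r ?mul0r.
Qed.

Lemma conv_tr0_tr0 z : conv ind_tr0 ind_tr0 z = Q ^+ 2 * ind_tr0 z.
Proof.
rewrite conv_tr0 -(sum_1_fiber (tr_in z)) mulr_suml.
by apply: eq_bigr => x /eqP tx; rewrite mul1r /ind_tr0 tx.
Qed.

Lemma conv_tr0_1 z : conv ind_tr0 (fun=> 1) z = Q ^+ 2.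
Proof. by rewrite conv_tr0 (sum_1_fiber (tr_in z)). Qed.

Lemma conv_tr0_type z : conv ind_tr0 line_type z = Q * (1 - ind_tr0 z).
Proof. by rewrite conv_tr0 (sum_line_type_fiber (tr_in z)). Qed.

Lemma conv_1_1 z : conv (fun=> 1) (fun=> 1) z = Q ^+ 3.
Proof.
by rewrite /conv mulr1 sumr_const cardF [(3 * s)%N]mulnC expnM [LHS]natrX.
Qed.

Lemma conv_1_type z : conv (fun=> 1) line_type z = Q * (Q - 1).
Proof.
rewrite convC /conv; under eq_bigr do rewrite mulr1; exact: sum_line_type.
Qed.

(** Expand |S_x| in [sum_on_line_corr] by [card_on_line_type]; the other
convolutions that appear are known, and the square of q - 1 cancels. *)
Lemma conv_type_type z :
  conv line_type line_type z
  = (Q ^+ 2 - 2 * Q) * line_type z + (Q ^+ 3 - Q ^+ 2) * ind0 z.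
Proof.
have natE n m : (0 < n)%N ->
    ((n ^ 2 - 1) * (n * (n ^ 2 - n)) + n ^ 2 * (n - 1) * m)%:R =
    (n%:R ^+ 2 - 1) * (n%:R * (n%:R ^+ 2 - n%:R))
      + n%:R ^+ 2 * (n%:R - 1) * m%:R :> rat.
  move=> n0; have n2 : (n <= n ^ 2)%N by rewrite -{1}[n]expn1 leq_pexp2l.
  rewrite natrD !natrM !natrB ?expn_gt0 ?n0 //.
  ring.
have := congr1 (fun n => n%:R : rat) (sum_on_line_corr z).
rewrite (natE _ _ q_gt0) natr_sum.
under eq_bigr do rewrite natrM !card_on_line_type.
have -> : \sum_x (Q - 1) * (line_type x + Q * (x == 0)%:R + 1) *
     ((Q - 1) * (line_type (x + z) + Q * (x + z == 0)%:R + 1)) =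
   (Q - 1) ^+ 2 * (conv line_type line_type z + Q * conv line_type ind0 z
     + conv line_type (fun=> 1) z
     + Q * (conv ind0 line_type z + Q * conv ind0 ind0 z + conv ind0 (fun=> 1) z)
     + conv (fun=> 1) line_type z + Q * conv (fun=> 1) ind0 z
     + conv (fun=> 1) (fun=> 1) z).
  rewrite /conv !mulr_sumr -!big_split /= !mulr_sumr -!big_split /= mulr_sumr.
  by apply: eq_bigr => x _; rewrite /ind0; ring.
rewrite (convC line_type ind0) (convC line_type (fun=> 1)).
rewrite (convC (fun=> 1) ind0) !conv_ind0.
rewrite conv_1_type conv_1_1 card_on_line_type -/(ind0 z) => E.
have Q0 := Q1_neq0.
apply: (mulfI (expf_neq0 2 Q0)); move: E; move: (conv _ _ _) => c E.
by move: Q E => Q1 E; lra.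
Qed.

(** The index i such that x lies in R_i. *)
Definition class_of (x : F) : 'I_4 :=
  if x == 0 then inord 0 else
  if tr x == 0 then inord 1 else if line_type x == 1 then inord 2 else inord 3.

Definition class_basis (m : 'I_4) : F -> rat :=
  nth (fun=> 0) [:: ind0; ind_tr0; fun=> 1; line_type] m.

(** The indicator functions of the four classes in terms of class_basis. *)
Definition class_coef : 'M[rat]_4 := mx_of_rows 4
  [:: [:: 1; 0; 0; 0]; [:: -1; 1; 0; 0];
      [:: 0; - (1 / 2); 1 / 2; 1 / 2]; [:: 0; - (1 / 2); 1 / 2; - (1 / 2)]].

(** The multiplication table of class_basis under convolution, where n, m and v
stand for the values of ind0, ind_tr0 and line_type. *)
Definition basis_conv (n m v : rat) : 'M[rat]_4 := mx_of_rows 4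
  [:: [:: n; m; 1; v];
      [:: m; Q ^+ 2 * m; Q ^+ 2; Q * (1 - m)];
      [:: 1; Q ^+ 2; Q ^+ 3; Q * (Q - 1)];
      [:: v; Q * (1 - m); Q * (Q - 1);
          (Q ^+ 2 - 2 * Q) * v + (Q ^+ 3 - Q ^+ 2) * n]].

Lemma basis_convE l m z :
  conv (class_basis l) (class_basis m) z
  = basis_conv (ind0 z) (ind_tr0 z) (line_type z) l m.
Proof.
rewrite mxE /class_basis.
case: l m => [[|[|[|[|//]]]] ltl] [[|[|[|[|//]]]] ltm] /=;
  rewrite ?conv_ind0 ?[conv _ ind0 z]convC ?conv_ind0 ?conv_tr0_tr0 ?conv_tr0_1
  ?conv_tr0_type ?[conv _ ind_tr0 z]convC ?conv_tr0_1 ?conv_tr0_type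
  ?conv_1_1 ?conv_1_type ?[conv _ (fun=> 1) z]convC ?conv_1_type ?conv_type_type //.
Qed.

Lemma class_of_values z : (ind0 z, ind_tr0 z, line_type z) =
  nth (0, 0, 0) [:: (1, 1, 0); (0, 1, 0); (0, 0, 1); (0, 0, -1)] (class_of z).
Proof.
rewrite /class_of /ind0 /ind_tr0; have [->|z0] := eqVneq z 0.
  by rewrite inordK //= /line_type tr0 eqxx.
have [tz|tz] := eqVneq (tr z) 0; first by rewrite inordK //= /line_type tz eqxx.
have := line_type_values tz; case: eqP => [->|_] /=; first by rewrite inordK.
by move/eqP->; rewrite inordK.
Qed.

Lemma class_coefE i x :
  (class_of x == i)%:R = \sum_m class_coef i m * class_basis m x.
Proof.
have := class_of_values x; rewrite !big_ord_recl big_ord0 /class_basis !mxE /=.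
move: (ind0 x) (ind_tr0 x) (line_type x) => n m v.
case: (class_of x) i => [[|[|[|[|//]]]] ltx] [[|[|[|[|//]]]] lti] /= [-> -> ->];
  rewrite ?eqE /= ?mulr1n ?mulr0n; by field.
Qed.

(** The indicator of R_0 = {0} is the unit for convolution, hence the identity
matrix for the index 0. *)
Definition structure_mx (i : 'I_4) : 'M[rat]_4 :=
  nth 0 [:: 1%:M; B1 Q; B2 Q; B3 Q] i.

(** By bilinearity from [basis_convE], since the functions of class_basis are
constant on each class. *)
Lemma conv_class_of i j z :
  \sum_x (class_of x == i)%:R * (class_of (x + z) == j)%:R
  = structure_mx i (class_of z) j.
Proof.
transitivity (\sum_l \sum_m class_coef i l * class_coef j m *
    basis_conv (ind0 z) (ind_tr0 z) (line_type z) l m).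
  under eq_bigr do rewrite !class_coefE big_distrlr /=.
  rewrite exchange_big; apply: eq_bigr => l _ /=.
  rewrite exchange_big; apply: eq_bigr => m _ /=.
  rewrite -basis_convE /conv mulr_sumr; apply: eq_bigr => x _; ring.
have := class_of_values z; move: (ind0 z) (ind_tr0 z) (line_type z) => n m v.
rewrite !big_ord_recl !big_ord0 !mxE /=.
case: (class_of z) i j => [[|[|[|[|//]]]] ltz] [[|[|[|[|//]]]] lti]
  [[|[|[|[|//]]]] ltj] /= [-> -> ->];
  rewrite /structure_mx /= !mxE /= ?mulr1n ?mulr0n; by field.
Qed.

Lemma on_lineZ c x : c \in K -> c != 0 -> on_line (c * x) = on_line x.
Proof.
move=> cK c0; apply/setP => u; rewrite [LHS]inE [RHS]inE.
by rewrite -mulrA (trZ _ cK) mulf_eq0 (negPf c0).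
Qed.

Lemma card_on_line_tangent x : x != 0 ->
  (#|on_line x| == (q - 1)%N) = (tr x == 0).
Proof.
move=> x0; apply/eqP/eqP => [ox|]; last exact: card_tangent.
apply/eqP/negPn/negP => tx; have [xx|[u xu]] := set_0Vmem (on_line x).
  by move: ox q_gt1; rewrite xx cards0; lia.
by move: ox q_gt1; rewrite (card_secant tx xu); lia.
Qed.

Lemma card_on_line_secant x : tr x != 0 ->
  (#|on_line x| == (2 * (q - 1))%N) = (line_type x == 1).
Proof.
move=> tx; rewrite /line_type (negPf tx) subr_eq eq_sym -(inj_eq (mulIf Q1_neq0)).
rewrite divfK ?Q1_neq0 // -natr_q1 -[1 + 1]/(2%:R) -natrM eqr_nat.
by rewrite eq_sym.
Qed.

Lemma class_of_on_line x : x != 0 ->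
  class_of x = if #|on_line x| == (q - 1)%N then inord 1
          else if #|on_line x| == (2 * (q - 1))%N then inord 2 else inord 3.
Proof.
move=> x0; rewrite /class_of (negPf x0) card_on_line_tangent //.
by case: (boolP (tr x == 0)) => // tx; rewrite card_on_line_secant.
Qed.

Lemma class_of_eq0 x : (class_of x == ord0) = (x == 0).
Proof.
rewrite -(inj_eq val_inj) /class_of; case: (x == 0); first by rewrite /= inordK.
by case: (tr x == 0); [|case: (line_type x == 1)]; rewrite /= inordK.
Qed.

(** The size of the class k is the intersection number p_{k,k}^0, and the three
nontrivial ones are q^2 - 1, q (q-1) (q+1) / 2 and q (q-1)^2 / 2. *)
Lemma class_of_surj k : exists x, class_of x = k.
Proof.
have : \sum_x (class_of x == k)%:R != 0 :> rat.
  have -> : \sum_x (class_of x == k)%:R = structure_mx k ord0 k.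
    have <- : class_of 0 = ord0 by apply/eqP; rewrite class_of_eq0.
    rewrite -conv_class_of; apply: eq_bigr => x _.
    by rewrite addr0 -natrM mulnb andbb.
  have Q1 : 0 < Q - 1 by rewrite subr_gt0 ltr1n q_gt1.
  have Q0 : 0 < Q by rewrite ltr0n q_gt0.
  rewrite /structure_mx.
  case: k => [[|[|[|[|//]]]] ltk] /=; rewrite !mxE //=; apply: lt0r_neq0.
  - have -> : Q ^+ 2 - 1 = (Q - 1) * (Q + 1) by ring.
    by rewrite mulr_gt0 // addr_gt0.
  - have -> : 1 / 2 * Q ^+ 3 - 1 / 2 * Q = 1 / 2 * (Q * ((Q - 1) * (Q + 1))).
      by field.
    by rewrite !mulr_gt0 // addr_gt0.
  have -> : 1 / 2 * Q ^+ 3 - Q ^+ 2 + 1 / 2 * Q = 1 / 2 * (Q * (Q - 1) ^+ 2).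
    by field.
  by rewrite !mulr_gt0 // exprn_gt0.
case: (pickP (fun x => class_of x == k)) => [x /eqP cx|no_x]; first by exists x.
by rewrite big1 ?eqxx // => x _; rewrite no_x.
Qed.

End CubicExtension.

(** * Association schemes from partitions of an abelian group *)

(** A partition of an abelian group into symmetric sets is encoded by the map c
sending an element to the index of its part. *)
Section TranslationScheme.

Variables (X : finZmodType) (d : nat).
Variables (S : 'I_d.+1 -> {set X}) (c : X -> 'I_d.+1).
Variable p : 'I_d.+1 -> 'I_d.+1 -> 'I_d.+1 -> rat.

Hypothesis mem_S : forall i x, (x \in S i) = (c x == i).
Hypothesis c_surj : forall k, exists x, c x = k.
Hypothesis c_eq0 : forall x, (c x == ord0) = (x == 0).
Hypothesis c_opp : forall x, c (- x) = c x.
Hypothesis c_conv : forall i j z,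
  \sum_x (c x == i)%:R * (c (z - x) == j)%:R = p i j (c z).

Lemma mem_translation_relations i x y :
  ((x, y) \in translation_relations S i) = (c (y - x) == i).
Proof.
apply/imset2P/idP => [[x' v _] | cxy].
  by rewrite mem_S => cv [-> ->]; rewrite addrAC subrr add0r.
exists x (y - x); rewrite ?mem_S ?inE //.
by rewrite addrCA subrr addr0.
Qed.

Lemma adjacency_mxM i j x y :
  (adjacency_mx (translation_relations S i) *m
   adjacency_mx (translation_relations S j)) x y
  = p i j (c (enum_val y - enum_val x)).
Proof.
rewrite mxE -c_conv (reindex_inj (addIr (- enum_val x))) /=.
rewrite [RHS](reindex (@enum_val X X)) /=; last exact/onW_bij/enum_val_bij.
apply: eq_bigr => m _; rewrite !mxE !mem_translation_relations.
by rewrite opprB addrA subrK.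
Qed.

Lemma sum_adjacency_mx (a : 'I_d.+1 -> rat) x y :
  (\sum_k a k *: adjacency_mx (translation_relations S k)) x y
  = a (c (enum_val y - enum_val x)).
Proof.
rewrite summxE (bigD1 (c (enum_val y - enum_val x))) //= !mxE.
rewrite mem_translation_relations eqxx mulr1 big1 ?addr0 // => k.
by rewrite !mxE mem_translation_relations eq_sym => /negPf->; rewrite mulr0.
Qed.

Lemma translation_association_scheme : association_scheme (translation_relations S).
Proof.
have injR : injective (translation_relations S).
  move=> i j eqR; have [x cx] := c_surj i; apply/eqP.
  have := mem_translation_relations i 0 x.
  by rewrite eqR mem_translation_relations subr0 cx eqxx => ->.
split.
- split=> //; apply/and3P; split.
  + apply/eqP/setP => -[x y]; rewrite inE; apply/bigcupP.
    exists (translation_relations S (c (y - x))); first exact: imset_f.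
    by rewrite mem_translation_relations.
  + apply/trivIsetP => _ _ /imsetP[i _ ->] /imsetP[j _ ->] neq.
    rewrite -setI_eq0; apply/eqP/setP => -[x y].
    rewrite inE !mem_translation_relations inE; apply/andP => -[/eqP ci /eqP cj].
    by rewrite -ci -cj eqxx in neq.
  + apply/imsetP => -[i _ R0]; have [x cx] := c_surj i.
    have := mem_translation_relations i 0 x.
    by rewrite subr0 cx eqxx -R0 inE.
- apply/setP => -[x y]; rewrite mem_translation_relations c_eq0 subr_eq0.
  by apply/eqP/imsetP => [->|[z _ [-> ->]]] //; exists x.
- by move=> i x y; rewrite !mem_translation_relations -c_opp opprB.
exists p => i j; apply/matrixP => x y.
by rewrite adjacency_mxM sum_adjacency_mx.
Qed.

Lemma intersection_numbers_unique p' :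
  intersection_numbers (translation_relations S) p' ->
  forall i j k, p' i j k = p i j k.
Proof.
move=> p'P i j k; have [x cx] := c_surj k.
have := congr1 (fun A : 'M_#|X| => A (enum_rank (0 : X)) (enum_rank x)) (p'P i j).
by rewrite adjacency_mxM sum_adjacency_mx !enum_rankK subr0 cx.
Qed.

End TranslationScheme.

(** * Cyclotomic classes and lines *)

Section CyclotomicClasses.

Variables (s : nat) (s_gt0 : (0 < s)%N).
Variables (F : finFieldType) (cardF : #|F| = (2 ^ (3 * s))%N).
Variables (E : {subfield (extF cardF)}) (cardE : #|E| = (2 ^ s)%N).
Variables (w : {unit F}) (w_primitive : generator [set: {unit F}] w).

Local Notation q := (2 ^ s)%N.
Local Notation M := (numM s).

Lemma card_frobenius_fixed : #|base F s| = q.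
Proof.
by rewrite -cardE; apply: eq_card => x; rewrite inE (mem_subfield_frobenius cardE).
Qed.

Lemma numM_mul : (M * (q - 1) = 2 ^ (3 * s) - 1)%N.
Proof.
rewrite /numM divnK // [(3 * s)%N]mulnC expnM !subn1.
by rewrite [(_ ^ 3).-1]predn_exp dvdn_mulr.
Qed.

Lemma numM_gt1 : (1 < M)%N.
Proof.
have q1 := q_gt1 s_gt0.
rewrite -(ltn_pmul2r (m := q - 1)) ?subn_gt0 // mul1n numM_mul.
have : (q < 2 ^ (3 * s))%N by rewrite ltn_exp2l //; lia.
by lia.
Qed.

(** As M (q-1) = q^3 - 1, the element w^M satisfies x^q = x. *)
Lemma generator_pow_base k : val w ^+ M ^+ k \in base F s.
Proof.
apply: baseX; apply/baseP; rewrite -exprM.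
have -> : (M * q = 2 ^ (3 * s) + M.-1)%N.
  have := numM_mul; have := numM_gt1; have := q_gt1 s_gt0.
  have : (0 < 2 ^ (3 * s))%N by rewrite expn_gt0.
  by move: (2 ^ (3 * s))%N q M => *; nia.
by rewrite exprD -cardF expf_card -exprS prednK // ltnW ?numM_gt1.
Qed.

Lemma card_S_on_line a : #|S_ E w a| = #|on_line s (val w ^+ a)|.
Proof.
rewrite -(card_imset _ val_inj); apply: eq_card => x.
apply/imsetP/idP => [[u]|].
  rewrite !inE !(trFE_frobenius s_gt0 cardE) => /andP[Qu tu] ->.
  by rewrite -unitfE (valP u) Qu.
rewrite inE => /andP[/[!inE]/andP[x0 Qx] tx].
have xU : x \is a GRing.unit by rewrite unitfE.
exists (Sub x xU); last by rewrite SubK.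
by rewrite !inE !(trFE_frobenius s_gt0 cardE) !SubK; apply/andP.
Qed.

(** The line of x depends only on the class of x modulo E^*. *)
Lemma cyclotomic_classP a x : x \in cyclotomic_class w a ->
  x != 0 /\ #|S_ E w a| = #|on_line s x|.
Proof.
case/imsetP => u /lcosetP[_ /cycleP[k ->] ->] ->; split.
  by rewrite -unitfE; apply: valP.
rewrite card_S_on_line FinRing.val_unitM !FinRing.val_unitX.
rewrite mulrC on_lineZ ?generator_pow_base // !expf_neq0 // -unitfE.
exact: (valP w).
Qed.

Lemma cyclotomic_class_cover x :
  x != 0 -> exists a, x \in @cyclotomic_class s F w a.
Proof.
rewrite -unitfE => xU; pose u : {unit F} := Sub x xU.
have /cycleP[n un] : u \in <[w]>%g by rewrite -(eqP w_primitive) inE.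
exists (n%:R); apply/imsetP; exists u; last by rewrite SubK.
apply/lcosetP; exists (w ^+ M ^+ (n %/ M))%g; first exact: mem_cycle.
by rewrite un val_Zp_nat ?numM_gt1 // -expgM -expgD [(M * _)%N]mulnC addnC -divn_eq.
Qed.

(** The cyclotomic classes cover the nonzero elements, and for x in the class of
a the line of x has as many vectors of the conic as S_a has elements. *)
Lemma mem_R i x : (x \in R_ E w i) = (class_of s x == i).
Proof.
have [->|x0] := eqVneq x 0.
  have no0 (T : {set 'Z_M}) : (0 \in \bigcup_(a in T) cyclotomic_class w a) = false.
    by apply/bigcupP => -[a _ /cyclotomic_classP[/eqP]].
  have /eqP-> : class_of s (0 : F) == ord0 by rewrite class_of_eq0.
  by case: i => [[|[|[|[|//]]]] lti] /=; rewrite /R_ /= ?no0 // inE eqxx.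
have [a xa] := cyclotomic_class_cover x0.
have [_ oS] := cyclotomic_classP xa.
rewrite (class_of_on_line s_gt0 cardF card_frobenius_fixed x0) -oS.
have xT (T : {set 'Z_M}) (P : pred nat) : (forall b, (b \in T) = P #|S_ E w b|) ->
    (x \in \bigcup_(b in T) cyclotomic_class w b) = P #|S_ E w a|.
  move=> TP; apply/bigcupP/idP => [[b bT /cyclotomic_classP[_ oSb]]|Pa].
    by rewrite oS -oSb -TP.
  by exists a; rewrite ?TP.
have T1P b : (b \in T1 E w) = (#|S_ E w b| == q - 1)%N by rewrite inE.
have T2P b : (b \in T2 E w) = (#|S_ E w b| == 2 * (q - 1))%N by rewrite inE.
have T3P b : (b \in T3 E w) =
    ((#|S_ E w b| != q - 1) && (#|S_ E w b| != 2 * (q - 1)))%N.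
  by rewrite inE inE negb_or T1P T2P.
have q1 := q_gt1 s_gt0.
rewrite /R_ -[RHS](inj_eq val_inj) /=.
rewrite (fun_if val) (fun_if val (_ == (2 * _)%N)) /= !inordK //.
case: i => [[|[|[|[|//]]]] lti] /=.
- by rewrite inE (negPf x0); do ?case: ifP.
- apply: etrans (xT _ (fun n => n == q - 1)%N T1P) _.
  by move: #|_| => n /=; case: (n == _); case: (n == _).
- apply: etrans (xT _ (fun n => n == 2 * (q - 1))%N T2P) _.
  move: #|_| => n /=; have [->|_] := eqVneq n (q - 1)%N.
    by rewrite ltn_eqF //; lia.
  by case: (n == _).
apply: etrans (xT _ (fun n => (n != q - 1) && (n != 2 * (q - 1)))%N T3P) _.
by move: #|_| => n /=; case: (n == _); case: (n == _).
Qed.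

End CyclotomicClasses.

Theorem theorem5 (s : nat) (s_gt0 : (0 < s)%N)
    (F : finFieldType) (cardF : #|F| = (2 ^ (3 * s))%N)
    (E : {subfield (extF cardF)}) (cardE : #|E| = (2 ^ s)%N)
    (w : {unit F}) (w_primitive : generator [set: {unit F}] w) :
  association_scheme (translation_relations (R_ E w)) /\
  forall p, intersection_numbers (translation_relations (R_ E w)) p ->
    [/\ intersection_mx p (inord 1) = B1 (2 ^ s)%:R,
        intersection_mx p (inord 2) = B2 (2 ^ s)%:R
      & intersection_mx p (inord 3) = B3 (2 ^ s)%:R].
Proof.
have oK := card_frobenius_fixed cardE.
pose p0 i j k := structure_mx s i k j.
have class_ofN x : class_of s (- x : F) = class_of s x by rewrite (oppF cardF).
have class_of_conv i j z :
    \sum_(x : F) (class_of s x == i)%:R * (class_of s (z - x) == j)%:R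
    = p0 i j (class_of s z).
  rewrite /p0 -(conv_class_of s_gt0 cardF oK); apply: eq_bigr => x _.
  by rewrite (oppF cardF) addrC.
have RP := mem_R s_gt0 cardE w_primitive.
have surj := class_of_surj s_gt0 cardF oK.
have eq0 := @class_of_eq0 F s.
split.
  exact: translation_association_scheme RP surj eq0 class_ofN class_of_conv.
move=> p pP; have pE := intersection_numbers_unique RP surj class_of_conv pP.
have E' i : intersection_mx p i = structure_mx s i.
  by apply/matrixP => k j; rewrite !mxE pE.
by rewrite !E' /structure_mx !inordK.
Qed.
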